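(* Let $m\ge 2$ be a fixed integer and let $q\in(0,1)$. For each $n$ let $\kappa=(k_1,\ldots,k_m)\in\mathcal{P}_n(m)$ be chosen with probability $P(\kappa)=c\cdot q^{k_1}$, where $c=c_{n,m}$ is the normalizing constant such that $\sum_{\kappa\in\mathcal{P}_n(m)}P(\kappa)=1$. Consider the subsequence of integers $n\equiv j_0 \pmod m$, where $0\le j_0\le m-1$, and define $j=j_0$ if $1\le j_0\le m-1$ and $j=m$ if $j_0=0$. Then, as $n\to\infty$ along this subsequence, $\big(k_1-\lceil \frac{n}{m}\rceil,\ldots,k_m-\lceil \frac{n}{m}\rceil\big)$ converges in distribution to a discrete random vector with probability mass function $$f(l_1,\ldots,l_m)=\frac{q^{l_1}}{\sum_{l=0}^{\infty}q^{l}\cdot|\mathcal{P}_{m(l+1)-j}(m-1)|}$$ for all integers $(l_1,\ldots,l_m)$ with $l_1\ge 0$, $l_1\ge\cdots\ge l_m$ and $\sum_{i=1}^m l_i=j-m$.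
   Context: For integers $n,m\ge 1$, $\mathcal{P}_n(m)$ denotes the set of partitions of $n$ with at most $m$ parts; its elements are written as $\kappa=(k_1,\ldots,k_m)$ with integers $k_1\ge k_2\ge\cdots\ge k_m\ge 0$ and $\sum_{i=1}^m k_i=n$ (shorter partitions are padded with zeros). $|A|$ denotes the cardinality of a set $A$, and by convention $|\mathcal{P}_0(k)|=1$ for every $k$. $\lceil x\rceil$ is the smallest integer $\ge x$. *)

(* Defs.v *)
From HB Require Import structures.
From mathcomp Require Import all_boot all_order all_algebra.
From mathcomp Require Import all_classical all_reals all_analysis.

Set Implicit Arguments.
Unset Strict Implicit.
Unset Printing Implicit Defensive.
Import Order.TTheory GRing.Theory Num.Theory.
Import numFieldNormedType.Exports.

Local Open Scope classical_set_scope.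
Local Open Scope ring_scope.

Definition is_partition (n m : nat) (k : m.-tuple nat) : bool :=
  sorted geq k && (sumn k == n).

Definition tuple_of_ords (n m : nat) (k : m.-tuple 'I_n) : m.-tuple nat :=
  map_tuple (@nat_of_ord n) k.

(* The parts of a partition of [n] are at most [n], so nothing is lost by
   letting them range over ['I_n.+1]; this makes the cardinality available. *)
Definition partitions (n m : nat) : {set m.-tuple 'I_n.+1} :=
  [set k | is_partition n (tuple_of_ords k)].

Definition partition_prob (R : realType) (q : R) (n m : nat)
    (k : m.-tuple nat) : R :=
  q ^+ head 0%N k /
  \sum_(h in partitions n m) q ^+ head 0%N (tuple_of_ords h).

(* ['rV[R]_m] with its Borel sigma-algebra. *)
Definition borel_rV (R : realType) (m : nat) :=
  g_sigma_algebraType (@open 'rV[R]_m).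

Definition centered (R : realType) (n m : nat) (k : m.-tuple nat) :
    borel_rV R m :=
  \row_(i < m) ((tnth k i)%:R - (Num.ceil (n%:R / m%:R : R))%:~R).

Lemma measurable_tuple_nat (m : nat) (A : set (m.-tuple nat)) : measurable A.
Proof.
apply: countable_measurable; last first.
  by rewrite -(image_id A); exact: countableP.
move=> t.
have -> : [set t] =
    \bigcap_(i in [set: 'I_m]) ((fun k : m.-tuple nat => tnth k i) @^-1` [set tnth t i]).
  apply/seteqP; split=> [_ -> //|k /= kt].
  by apply: eq_from_tnth => i; exact: kt.
apply: fin_bigcap_measurable => [|i _]; first exact: finite_finset.
rewrite -[X in measurable X]setTI.
exact: (@measurable_tnth _ nat m i measurableT [set tnth t i] I).
Qed.

Lemma measurable_centered (R : realType) (n m : nat) :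
  measurable_fun [set: m.-tuple nat] (@centered R n m).
Proof. by move=> _ A _; exact: measurable_tuple_nat. Qed.

HB.instance Definition _ (R : realType) (n m : nat) :=
  isMeasurableFun.Build _ _ (m.-tuple nat) (borel_rV R m) (@centered R n m)
    (@measurable_centered R n m).

Definition centered_RV (R : realType) (d : measure_display)
    (T : measurableType d) (P : probability T R) (n m : nat)
    (kappa : {RV P >-> m.-tuple nat}) : {RV P >-> borel_rV R m} :=
  @centered R n m \o kappa.

(* Convergence in distribution of [X n] to [Y] as [n] tends to infinity along
   the filter [F]: expectations of all bounded continuous functions converge.
   The [X n] need not live on a common probability space. *)
Definition cvg_in_distribution (R : realType) (m : nat) (F : set_system nat)
    (d : nat -> measure_display) (T : forall n, measurableType (d n))
    (P : forall n, probability (T n) R) (X : forall n, {RV (P n) >-> borel_rV R m})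
    (d' : measure_display) (T' : measurableType d') (P' : probability T' R)
    (Y : {RV P' >-> borel_rV R m}) : Prop :=
  forall g : 'rV[R]_m -> R, continuous g -> (exists M, forall x, `|g x| <= M) ->
    'E_(P n)[g \o X n]%E @[n --> F] --> 'E_P'[g \o Y]%E.

Definition int_rV (R : realType) (m : nat) (l : m.-tuple int) : borel_rV R m :=
  \row_(i < m) (tnth l i)%:~R.

(* [Y] takes its values in [S] almost surely, with point masses [f]; in
   particular [f] has sum 1 over [S]. *)
Definition has_pmf (R : realType) (m : nat) (d : measure_display)
    (T : measurableType d) (P : probability T R) (Y : {RV P >-> borel_rV R m})
    (S : set (m.-tuple int)) (f : m.-tuple int -> R) : Prop :=
  (forall l, S l -> P (Y @^-1` [set int_rV R l]) = (f l)%:E) /\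
  P (Y @^-1` (@int_rV R m @` S)) = 1%E.

Definition limit_support (m j : nat) : set (m.-tuple int) :=
  [set l | [/\ 0 <= head 0 l, sorted >=%R l &
               \sum_(x <- l) x = j%:Z - m%:Z]].

(* The subtraction does not truncate when [j <= m]. *)
Definition limit_pmf (R : realType) (q : R) (m j : nat) (l : m.-tuple int) : R :=
  q ^ head 0 l /
  limn [series q ^+ i * #|partitions (m * i.+1 - j) m.-1|%:R]_i.

(* Main.v *)
Require Import Defs.
From HB Require Import structures.
From mathcomp Require Import all_boot all_order all_algebra zify lra.
From mathcomp Require Import all_classical all_reals all_analysis measurable_realfun.
Set Implicit Arguments.
Unset Strict Implicit.
Unset Printing Implicit Defensive.
Import Order.TTheory GRing.Theory Num.Theory.
Import numFieldNormedType.Exports.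
Local Open Scope classical_set_scope.
Local Open Scope ring_scope.

(* Put [c = ceil (n / m)], so that [n + m = m c + j].  Subtracting [c] from every
   part identifies the partitions of [n] into at most [m] parts with the vectors
   [l] of the limit support such that [l_m >= - c], and it multiplies the weight
   [q ^ k_1] by the constant [q ^ (- c)].  Hence the law of the centered partition
   is the limit law conditioned on [l_m >= - c], an event that increases to the
   full support: expectations of bounded functions are quotients of two truncated
   integrals against the limit law, and dominated convergence applies to both.
   The limit weights are summable because the vectors with [l_1 = i] correspond to
   the partitions of [m (i + 1) - j] into at most [m - 1] parts, whose number is
   polynomially bounded in [i]. *)

(** * Enumerating and counting partitions *)

(** Leaving the ordinals, whose bound depends on [n], puts the partitions of all [n] into one type,
    so that they can be shifted and compared as [n] varies. *)
Definition partition_seq (n m : nat) : seq (m.-tuple nat) :=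
  [seq tuple_of_ords h | h <- enum (partitions n m)].

Lemma tuple_of_ords_inj (n m : nat) : injective (@tuple_of_ords n m).
Proof.
move=> h h' /(congr1 val) /= /inj_map hh'.
by apply: val_inj; apply: hh'; exact: val_inj.
Qed.

Lemma partition_seq_uniq (n m : nat) : uniq (partition_seq n m).
Proof. by rewrite map_inj_uniq ?enum_uniq//; exact: tuple_of_ords_inj. Qed.

Lemma size_partition_seq (n m : nat) :
  size (partition_seq n m) = #|partitions n m|.
Proof. by rewrite size_map cardE. Qed.

Lemma big_partition_seq (V : nmodType) (n m : nat) (F : m.-tuple nat -> V) :
  \sum_(h in partitions n m) F (tuple_of_ords h) =
  \sum_(t <- partition_seq n m) F t.
Proof. by rewrite big_map -big_enum. Qed.

Lemma leq_mem_sumn (s : seq nat) (x : nat) : x \in s -> (x <= sumn s)%N.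
Proof. by elim: s => //= y s ih; rewrite inE => /predU1P[->|/ih]; lia. Qed.

Lemma mem_partition_seq (n m : nat) (t : m.-tuple nat) :
  (t \in partition_seq n m) = is_partition n t.
Proof.
apply/mapP/idP => [[h + ->]|tn]; first by rewrite mem_enum inE.
have /andP[_ /eqP sn] := tn.
have lt_t (i : 'I_m) : (tnth t i < n.+1)%N.
  by rewrite ltnS -sn; exact/leq_mem_sumn/mem_tnth.
exists [tuple Ordinal (lt_t i) | i < m].
  rewrite mem_enum inE [tuple_of_ords _](_ : _ = t)//.
  by apply: eq_from_tnth => i; rewrite tnth_map tnth_mktuple.
by apply: eq_from_tnth => i; rewrite tnth_map tnth_mktuple.
Qed.

Lemma is_partition_single (n p : nat) : is_partition n [tuple of n :: nseq p 0%N].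
Proof.
rewrite /is_partition /= sumn_nseq mul0n addn0 eqxx andbT.
by case: p => //= p; elim: p.
Qed.

Lemma card_partitions_gt0 (n p : nat) : (0 < #|partitions n p.+1|)%N.
Proof.
rewrite -size_partition_seq.
by have := is_partition_single n p; rewrite -mem_partition_seq; case: partition_seq.
Qed.

(** This crude bound is polynomial in [n] for fixed [m], which suffices against the geometric decay
    of [q ^ i]. *)
Lemma card_partitions_le (n m : nat) : (#|partitions n m| <= n.+1 ^ m)%N.
Proof. by rewrite (leq_trans (max_card _))// card_tuple card_ord. Qed.

(** * Centering: partitions as truncations of the limit support *)

Definition shift_tuple (m c : nat) (t : m.-tuple nat) : m.-tuple int :=
  [tuple of [seq x%:Z - c%:Z | x <- t]].

Lemma shift_inj (m c : nat) : injective (@shift_tuple m c).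
Proof.
move=> t t' /(congr1 val) /= /inj_map tt'.
by apply: val_inj; apply: tt' => x y /addIr [].
Qed.

Lemma sum_shift (m c : nat) (t : m.-tuple nat) :
  \sum_(x <- shift_tuple c t) x = (sumn t)%:Z - (m * c)%:Z.
Proof.
suff H (s : seq nat) :
    \sum_(x <- s) (x%:Z - c%:Z) = (sumn s)%:Z - (size s * c)%:Z.
  by rewrite big_map H size_tuple.
elim: s => [|x s ih]; first by rewrite big_nil mul0n.
by rewrite big_cons {}ih /= mulSn; lia.
Qed.

Lemma sorted_shift (m c : nat) (t : m.-tuple nat) :
  sorted >=%R (shift_tuple c t) = sorted geq t.
Proof.
by apply: mono_sorted => x y /=; rewrite lerD2r lez_nat.
Qed.

Lemma head_shift (p c : nat) (t : p.+1.-tuple nat) :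
  head 0 (shift_tuple c t) = (head 0%N t)%:Z - c%:Z.
Proof. by case/tupleP: t. Qed.

Lemma sumn_le_head (p : nat) (t : p.+1.-tuple nat) :
  sorted geq t -> (sumn t <= p.+1 * head 0%N t)%N.
Proof.
case/tupleP: t => x t /=; rewrite path_sortedE; last first.
  by move=> a b c /= ba cb; exact: leq_trans cb ba.
move=> /andP[+ _]; rewrite mulSn leq_add2l -[in (p * x)%N](size_tuple t).
elim: {p t}(tval t) => //= y s ih /andP[yx /ih sx].
by rewrite mulSn leq_add.
Qed.

Lemma shift_limit_support (p n c j : nat) (t : p.+1.-tuple nat) :
  (0 < j)%N -> (n + p.+1 = p.+1 * c + j)%N -> is_partition n t ->
  limit_support j (shift_tuple c t).
Proof.
move=> j0 nc /andP[st /eqP sn]; split.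
- rewrite head_shift; have := sumn_le_head st; rewrite sn => sh.
  (* Otherwise [k_1 + 1 <= c], so [n + m <= m (k_1 + 1) <= m c], against [n + m = m c + j] with
     [j > 0]. *)
  suff: (c <= head 0%N t)%N by lia.
  rewrite leqNgt; apply/negP => hc.
  have : (p.+1 * (head 0%N t).+1 <= p.+1 * c)%N by rewrite leq_pmul2l.
  rewrite mulnS; lia.
- by rewrite sorted_shift.
- by rewrite sum_shift sn; lia.
Qed.

Lemma limit_support_shift (m n c j : nat) (l : m.-tuple int) :
  (n + m = m * c + j)%N -> limit_support j l ->
  (forall i, - c%:Z <= tnth l i) ->
  exists2 t, is_partition n t & l = shift_tuple c t.
Proof.
move=> nc [_ sl suml] lc.
(* The lower bound [- c] on the entries makes [absz] the identity here. *)
pose t : m.-tuple nat := [tuple of [seq absz (x + c%:Z) | x <- l]].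
have lt : l = shift_tuple c t.
  apply: eq_from_tnth => i; rewrite !tnth_map.
  by rewrite gez0_abs ?addrK// -lerBlDr sub0r.
clearbody t; exists t => //; rewrite /is_partition -(sorted_shift c) -lt sl /=.
by apply/eqP; move: suml; rewrite lt sum_shift; lia.
Qed.

(** * Slices of the limit support by first entry *)

(* The parts of [e] are the deficits [i - l_m >= ... >= i - l_2] of the vector
   [l] with first entry [l_1 = i]. *)
Definition deficit_tuple (p i : nat) (e : p.-tuple nat) : p.+1.-tuple int :=
  [tuple of i%:Z :: rev [seq i%:Z - x%:Z | x <- e]].

Lemma deficit_tuple_inj (p i : nat) : injective (@deficit_tuple p i).
Proof.
move=> e e' /(congr1 val) /= [] /(can_inj revK) /inj_map ee'.
by apply: val_inj; apply: ee' => x y; lia.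
Qed.

Lemma sum_deficit_tuple (p i : nat) (e : p.-tuple nat) :
  \sum_(x <- deficit_tuple i e) x = (p.+1 * i)%:Z - (sumn e)%:Z.
Proof.
rewrite big_cons big_rev big_map.
suff H (s : seq nat) :
    \sum_(x <- s) (i%:Z - x%:Z) = (size s * i)%:Z - (sumn s)%:Z.
  by rewrite /= H size_tuple mulSn; lia.
elim: s => [|x s ih]; first by rewrite big_nil mul0n.
by rewrite big_cons {}ih /= mulSn; lia.
Qed.

Lemma sorted_deficit_tuple (p i : nat) (e : p.-tuple nat) :
  sorted >=%R (deficit_tuple i e) = sorted geq e.
Proof.
rewrite /= path_sortedE; last exact: rev_trans le_trans.
rewrite all_rev all_map rev_sorted sorted_map.
rewrite (eq_sorted (e' := geq)); last by move=> x y /=; lia.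
by rewrite (_ : all _ e)//; apply/allP => x _ /=; lia.
Qed.

(** With [m = p + 1], the deficits from [i] sum to [m i - (j - m) = m (i + 1) - j]. The first entry
    has deficit zero, which leaves at most [m - 1] parts. *)
Lemma limit_support_head (p j i : nat) : (0 < j <= p.+1)%N ->
  limit_support j `&` [set l : p.+1.-tuple int | head 0 l = i%:Z] =
  [set` [seq deficit_tuple i e | e <- partition_seq (p.+1 * i.+1 - j) p]].
Proof.
move=> /andP[j0 jp].
have Nj : (p.+1 * i.+1 - j + j = p.+1 * i.+1)%N.
  by rewrite subnK// mulnS (leq_trans jp)// leq_addr.
apply/seteqP; split=> [l [[_ sl suml] /= li]|_ /= /mapP[e + ->]]; last first.
  rewrite mem_partition_seq => /andP[se /eqP sume]; split=> //.
  by split=> //; [rewrite sorted_deficit_tuple|rewrite sum_deficit_tuple sume; move: Nj; rewrite mulnS; lia].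
have [e le] : exists e, l = deficit_tuple i e.
  have /allP l'i : all (>=%R i%:Z) (behead l).
    move: sl li; case: (tval l) => //= h l' /[swap] ->.
    by rewrite path_sortedE; [case/andP|exact: rev_trans le_trans].
  (* Later entries are at most [l_1 = i], so [absz] returns the deficits themselves; [rev] puts them
     in decreasing order. *)
  exists [tuple of rev [seq absz (i%:Z - x) | x <- behead_tuple l]].
  move: li; case/tupleP: l {sl suml} l'i => h l' /= l'i li.
  apply/val_inj => /=; congr (_ :: _); first by rewrite li.
  rewrite map_rev revK -map_comp -[LHS]map_id.
  by apply/eq_in_map => x /l'i /=; lia.
apply/mapP; exists e => //; rewrite mem_partition_seq /is_partition.
rewrite -(sorted_deficit_tuple i) -le sl /=; apply/eqP.
by move: suml Nj; rewrite le sum_deficit_tuple mulnS; lia.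
Qed.

(** * Summability of the limit weights *)

(** Each of the [n + 1] terms of the geometric sum up to [r ^ n] is at least [r ^ n], and the whole
    sum is at most [1 / (1 - r)]. *)
Lemma natr_expr_le (R : realType) (r : R) (n : nat) : 0 <= r -> r < 1 ->
  n.+1%:R * r ^+ n <= (1 - r)^-1.
Proof.
move=> r0 r1; have r1' : 0 < 1 - r by rewrite subr_gt0.
apply: (@le_trans _ _ (\sum_(i < n.+1) r ^+ i)).
  rewrite -[X in X%:R](card_ord n.+1) mulr_natl -sumr_const ler_sum// => i _.
  by rewrite ler_wiXn2l// ?ltW// -ltnS ltn_ord.
rewrite -[leRHS]mul1r ler_pdivlMr// mulrC -opprB mulNr -subrX1 opprB.
by rewrite gerBl exprn_ge0.
Qed.

Lemma is_cvg_partition_series (R : realType) (q : R) (p j : nat) :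
  0 < q -> q < 1 ->
  cvgn [series q ^+ i * #|partitions (p.+1 * i.+1 - j) p|%:R]_i.
Proof.
move=> q0 q1.
(* With [r ^ (p + 1) = q], [q ^ i (i + 1) ^ p = r ^ i ((i + 1) r ^ i) ^ p]. *)
pose r := q `^ p.+1%:R^-1.
have r0 : 0 < r by exact: powR_gt0.
have rq : r ^+ p.+1 = q.
  by rewrite -powR_mulrn ?ltW// -powRrM mulVf ?pnatr_eq0// powRr1// ltW.
have r1 : r < 1 by rewrite -(@expr_lt1 _ p.+1) ?rq// ltW.
apply: (@series_le_cvg _ _ (geometric ((p.+2%:R / (1 - r)) ^+ p) r)).
- by move=> i; rewrite mulr_ge0// exprn_ge0// ltW.
- move=> i; rewrite /geometric /= mulr_ge0// exprn_ge0//; last exact: ltW.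
  by rewrite divr_ge0// subr_ge0 ltW.
(* The partitioned number is at most [(p + 1) (i + 1)], and
   [(p + 1) (i + 1) + 1 <= (p + 2) (i + 1)]. One factor [r ^ i] of [q ^ i] is kept as the geometric
   term; the other [p] absorb the polynomial. *)
- move=> i; apply: (@le_trans _ _ (q ^+ i * (p.+2 * i.+1)%:R ^+ p)).
    rewrite ler_wpM2l//; first by rewrite exprn_ge0// ltW.
    rewrite -natrX ler_nat.
    rewrite (leq_trans (card_partitions_le _ _))//.
    have [->//|p0] := posnP p; rewrite leq_exp2r// mulSn.
    by have := leq_subr j (p.+1 * i.+1); rewrite !mulSn; lia.
  rewrite -rq -exprM mulSn exprD /geometric /= -mulrA [leLHS]mulrC ler_wpM2r//.
    by rewrite exprn_ge0// ltW.
  rewrite mulnC exprM -exprMn.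
  have c0 : 0 <= p.+2%:R / (1 - r) by rewrite divr_ge0// subr_ge0 ltW.
  rewrite lerXn2r ?nnegrE//; first by rewrite mulr_ge0// exprn_ge0// ltW.
  by rewrite natrM mulrCA ler_wpM2l// mulrC natr_expr_le// ltW.
- by apply: is_cvg_geometric_series; rewrite ger0_norm// ltW.
Qed.

(** * Discrete laws and integration against them *)

(** Transporting the masses along [pickle] puts the law on [nat], where every set is measurable.
    Countable additivity is the regrouping of a nonnegative sum over disjoint preimages. *)
Lemma discrete_probability (R : realType) (D : countType) (S : set D) (f : D -> R) :
  (forall l, 0 <= f l) -> \esum_(l in S) (f l)%:E = 1%E ->
  exists P : probability nat R,
    forall A, P A = \esum_(l in S `&` pickle @^-1` A) (f l)%:E.
Proof.
move=> f0 f1.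
pose mu (A : set nat) : \bar R := \esum_(l in S `&` pickle @^-1` A) (f l)%:E.
have mu0 : mu set0 = 0%E by rewrite /mu preimage_set0 setI0 esum_set0.
have mu_ge0 A : (0 <= mu A)%E by apply: esum_ge0 => l _; rewrite lee_fin.
have mu_sigma : semi_sigma_additive mu.
  move=> F _ tF _.
  have -> : mu (\bigcup_n F n) = (\sum_(0 <= i <oo) mu (F i))%E.
    rewrite /mu preimage_bigcup setI_bigcupr nneseries_sum_bigcup//.
      apply/trivIsetP => i k _ _ ik; move/trivIsetP : tF => /(_ i k I I ik) Fik.
      by rewrite -subset0 => l [[_ li] [_ lk]]; rewrite -[set0 l]/(set0 (pickle l)) -Fik.
  by apply: is_cvg_nneseries => n _ _.
pose mixin := isMeasure.Build _ nat R mu mu0 mu_ge0 mu_sigma.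
pose M : {measure set nat -> \bar R} := HB.pack mu mixin.
have M1 : M setT = 1%E by rewrite /M /= /mu preimage_setT setIT.
pose Pmixin := Measure_isProbability.Build _ _ _ M M1.
pose P : probability nat R := HB.pack (M : set nat -> \bar R) M Pmixin.
by exists P.
Qed.

Lemma measurable_EFin_factor (R : realType) (d : measure_display)
    (T : measurableType d) (D : Type) (X : T -> D) (phi : D -> R) (A : set T) :
  (forall B, measurable (X @^-1` B)) ->
  measurable_fun A (EFin \o (phi \o X)).
Proof.
move=> mX; apply: (@measurable_funS _ _ _ _ setT) => //.
by apply/measurable_EFinP => _ B _; rewrite setTI comp_preimage.
Qed.

Lemma integral_preimage_seq (R : realType) (d : measure_display)
    (T : measurableType d) (P : probability T R) (D : eqType) (X : T -> D)
    (s : seq D) (phi : D -> R) :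
  (forall A, measurable (X @^-1` A)) -> uniq s ->
  (\int[P]_(w in X @^-1` [set` s]) (phi (X w))%:E =
   \sum_(x <- s) (phi x)%:E * P (X @^-1` [set x]))%E.
Proof.
move=> mX; have mphi A : measurable_fun A (EFin \o (phi \o X)).
  exact: measurable_EFin_factor.
elim: s => [_|x s ih /= /andP[xs us]].
  by rewrite big_nil set_nil preimage_set0 integral_set0.
rewrite big_cons -ih// (_ : [set` x :: s] = [set x] `|` [set` s]); last first.
  by apply/seteqP; split=> y /=; rewrite inE => /predU1P.
rewrite preimage_setU integral_setU//.
- congr (_ + _)%E; rewrite -integral_cst//.
  by apply: eq_integral => w; rewrite inE /= => ->.
- apply/disj_setPLR => w /= -> .
  by rewrite (negbTE xs).
Qed.

(** The masses on [s] already add up to 1, so the complement of the preimage of [s] is a null set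
    and contributes nothing to the integral. *)
Lemma expectation_finite_support (R : realType) (d : measure_display)
    (T : measurableType d) (P : probability T R) (D : eqType) (X : T -> D)
    (s : seq D) (phi : D -> R) :
  (forall A, measurable (X @^-1` A)) -> uniq s ->
  (\sum_(x <- s) P (X @^-1` [set x]) = 1)%E ->
  ('E_P[phi \o X] = \sum_(x <- s) (phi x)%:E * P (X @^-1` [set x]))%E.
Proof.
move=> mX us s1.
have mphi A : measurable_fun A (EFin \o (phi \o X)).
  exact: measurable_EFin_factor.
have Ps : P (X @^-1` [set` s]) = 1%E.
  rewrite -s1 -[LHS]mul1e -integral_cst//.
  rewrite (integral_preimage_seq P (fun=> 1))//.
  by apply: eq_bigr => x _; rewrite mul1e.
rewrite unlock -integral_preimage_seq// -(setvU (X @^-1` [set` s])).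
rewrite integral_setU//; first last.
- by apply/disj_setPLR.
- exact: measurableC.
rewrite null_set_integral ?add0e//; first exact: measurableC.
by have := probability_setC P (mX [set` s]); rewrite Ps subee.
Qed.

(** Dominated convergence for [f] cut off outside [B c]: at each point of [E] the cut-off function
    is eventually equal to [f], the complement of [E] is null, and the constant [M] dominates. *)
Lemma cvg_integral_exhaustion (R : realType) (d : measure_display)
    (T : measurableType d) (P : probability T R) (f : T -> R) (M : R)
    (E : set T) (B : nat -> set T) :
  measurable_fun setT (EFin \o f) -> (forall x, `|f x| <= M) ->
  measurable E -> P E = 1%E -> (forall c, measurable (B c)) ->
  (forall x, E x -> \forall c \near \oo, B c x) ->
  (\int[P]_(x in B c) (f x)%:E)%E @[c --> \oo] --> ('E_P[f])%E.
Proof.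
move=> mf fM mE PE mB EB; rewrite unlock.
under eq_fun do rewrite integral_mkcond.
have Moo : P.-integrable setT (EFin \o cst M).
  exact: finite_measure_integrable_cst.
have [] // := @dominated_convergence _ _ _ P _ measurableT
  (fun c => (EFin \o f) \_ (B c)) (EFin \o f) (EFin \o cst M) _ mf _ Moo _.
- move=> c; apply/(measurable_restrictT _ (mB c)).
  exact: measurable_funS mf.
- exists (~` E); split; [exact: measurableC| |].
    by have := probability_setC P mE; rewrite PE subee.
  apply: subsetC => x /EB Bx _; apply: cvg_near_cst.
  by apply: filterS Bx => c Bc; rewrite patchE mem_set.
- apply: aeW => x c _; rewrite patchE; case: ifPn => _ /=.
    by rewrite lee_fin.
  by rewrite lee_fin normr0 (le_trans _ (fM x)).
Qed.

Lemma esum_seq (R : realType) (D : choiceType) (s : seq D) (a : D -> \bar R) :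
  uniq s -> (forall x, (0 <= a x)%E) ->
  \esum_(x in [set` s]) a x = (\sum_(x <- s) a x)%E.
Proof. by move=> us a0; rewrite esum_fset// -fsbig_seq. Qed.

(** * The limit law *)

Lemma partition_series_gt0 (R : realType) (q : R) (p j : nat) :
  0 < q -> q < 1 ->
  0 < limn [series q ^+ i * #|partitions (p.+2 * i.+1 - j) p.+1|%:R : R]_i.
Proof.
move=> q0 q1; have u0 i : 0 <= q ^+ i * #|partitions (p.+2 * i.+1 - j) p.+1|%:R.
  by rewrite mulr_ge0// exprn_ge0// ltW.
(* The limit dominates the partial sum of length 1, that is, the positive term at [i = 0]. *)
apply: lt_le_trans (nondecreasing_cvgn_le _ (@is_cvg_partition_series R q p.+1 j q0 q1) 1%N).
  by rewrite seriesEnat /= big_nat1 mulr_gt0// ?ltr0n ?card_partitions_gt0.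
by apply/nondecreasing_seqP => n; rewrite seriesEnat /= big_nat_recr//= lerDl.
Qed.

Lemma limit_pmf_ge0 (R : realType) (q : R) (p j : nat) (l : p.+2.-tuple int) :
  0 < q -> q < 1 -> 0 <= limit_pmf q j l.
Proof.
move=> q0 q1; rewrite divr_ge0 ?exprz_ge0//; first exact: ltW.
exact/ltW/partition_series_gt0.
Qed.

(** Slicing by first entry [i], each slice has as many atoms as the [i]-th coefficient of the
    normalizing series, all of the same mass, so the partial sums are those of the series divided by
    its limit. *)
Lemma esum_limit_pmf (R : realType) (q : R) (p j : nat) :
  0 < q -> q < 1 -> (0 < j <= p.+2)%N ->
  \esum_(l in @limit_support p.+2 j) (limit_pmf q j l)%:E = 1%E.
Proof.
move=> q0 q1 jp.
pose S i := limit_support j `&` [set l : p.+2.-tuple int | head 0 l = i%:Z].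
have -> : @limit_support p.+2 j = \bigcup_i S i.
  apply/seteqP; split=> [l ls|l [i _ []]//].
  by exists (absz (head 0 l)) => //; split=> //=; case: ls => l0 _ _; rewrite gez0_abs.
have f0 l : (0 <= (limit_pmf q j (l : p.+2.-tuple int))%:E)%E.
  by rewrite lee_fin limit_pmf_ge0.
rewrite nneseries_sum_bigcup//; last first.
  by apply/trivIsetP => i k _ _ /eqP ik; rewrite -subset0 => l [[_ li] [_]]; rewrite /= li => -[].
set u := fun i => q ^+ i * #|partitions (p.+2 * i.+1 - j) p.+1|%:R.
have uZ := @is_cvg_partition_series R q p.+1 j q0 q1.
have Z0 := @partition_series_gt0 R q p j q0 q1.
apply/cvg_lim => //.
rewrite (_ : (fun n => _) = EFin \o (fun n => series u n / limn (series u))).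
  apply/fine_cvgP; split; first exact: nearW.
  rewrite -(@divff _ (limn (series u))) ?gt_eqF//.
  by apply: cvgM => //; exact: cvg_cst.
apply/funext => n /=; rewrite seriesEnat /= mulr_suml -sumEFin.
apply: eq_bigr => i _; rewrite /S limit_support_head// esum_seq//; last first.
  by rewrite map_inj_uniq ?partition_seq_uniq//; exact: deficit_tuple_inj.
rewrite big_map /limit_pmf /= sumEFin; congr (_%:E).
by rewrite big_const_seq count_predT iter_addr_0 size_partition_seq mulrAC mulr_natr.
Qed.

(* The limit law lives on the codes [pickle l] of its atoms; numbers that are not
   codes get a junk value and have mass zero. *)
Definition decode_tuple (m : nat) (i : nat) : m.-tuple int :=
  odflt [tuple 0 | _ < m] (unpickle i).

Definition decode_rV (R : realType) (m : nat) (i : nat) : borel_rV R m :=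
  int_rV R (decode_tuple m i).

Lemma measurable_decode_rV (R : realType) (m : nat) :
  measurable_fun [set: nat] (@decode_rV R m).
Proof. by []. Qed.

HB.instance Definition _ (R : realType) (m : nat) :=
  isMeasurableFun.Build _ _ nat (borel_rV R m) (@decode_rV R m)
    (@measurable_decode_rV R m).

Lemma decode_tupleK (m : nat) : cancel pickle (decode_tuple m).
Proof. by move=> l; rewrite /decode_tuple pickleK. Qed.

Lemma int_rV_inj (R : realType) (m : nat) : injective (@int_rV R m).
Proof.
move=> l l' /rowP ll'; apply: eq_from_tnth => i.
by move: (ll' i); rewrite !mxE => /intr_inj.
Qed.

(** * Expectations for the centered partition *)

(** Here [n / m = c - (m - j) / m] with [0 <= m - j < m]; this is why residue 0 is represented by
    [j = m]. *)
Lemma ceil_shift (R : realType) (n m c j : nat) : (0 < j <= m)%N ->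
  (n + m = m * c + j)%N -> Num.ceil (n%:R / m%:R : R) = c%:Z.
Proof.
move=> /andP[j0 jm] nc; have m0 : 0 < m%:R :> R by rewrite ltr0n (leq_trans j0).
apply: ceil_def; rewrite ltr_pdivlMr// ler_pdivrMr//.
have : n%:R + m%:R = m%:R * c%:R + j%:R :> R by rewrite -natrM -!natrD nc.
have : 0 < j%:R :> R by rewrite ltr0n.
have : j%:R <= m%:R :> R by rewrite ler_nat.
by rewrite intrB -pmulrn => *; apply/andP; split; nra.
Qed.

Lemma centered_shift (R : realType) (n m c j : nat) (t : m.-tuple nat) :
  (0 < j <= m)%N -> (n + m = m * c + j)%N ->
  centered R n t = int_rV R (shift_tuple c t).
Proof.
move=> jm nc; apply/rowP => i; rewrite !mxE (ceil_shift R jm nc) tnth_map.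
by rewrite intrB -!pmulrn.
Qed.

Lemma expectation_partition (R : realType) (q : R) (p n c j : nat)
    (d : measure_display) (T : measurableType d) (P : probability T R)
    (kappa : {RV P >-> p.+2.-tuple nat}) (g : 'rV[R]_p.+2 -> R) :
  0 < q -> q < 1 -> (0 < j <= p.+2)%N -> (n + p.+2 = p.+2 * c + j)%N ->
  (forall t : p.+2.-tuple nat, is_partition n t ->
     P (kappa @^-1` [set t]) = (partition_prob q n t)%:E) ->
  ('E_P[g \o centered_RV n kappa] =
   ((\sum_(t <- partition_seq n p.+2)
      g (int_rV R (shift_tuple c t)) * limit_pmf q j (shift_tuple c t)) /
    \sum_(t <- partition_seq n p.+2) limit_pmf q j (shift_tuple c t))%:E)%E.
Proof.
move=> q0 q1 jp nc hP.
pose w (t : p.+2.-tuple nat) := limit_pmf q j (shift_tuple c t).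
pose W := \sum_(t <- partition_seq n p.+2) w t.
have probE t : partition_prob q n t = w t / W.
  have Z0 := @partition_series_gt0 R q p j q0 q1.
  (* The factor [q ^ c] undoes the shift and the series undoes the normalization of [limit_pmf]; [a]
     does not depend on the partition and cancels in the quotient. *)
  pose a := q ^+ c * limn [series q ^+ i * #|partitions (p.+2 * i.+1 - j) p.+1|%:R : R]_i.
  have a0 : a != 0 by rewrite mulf_neq0 ?gt_eqF// exprn_gt0.
  have wE s : q ^+ head 0%N (s : p.+2.-tuple nat) = a * w s.
    rewrite /w /limit_pmf head_shift /a mulrCA mulfK ?gt_eqF//.
    by rewrite !exprnP -expfzDr ?gt_eqF// subrK.
  rewrite /partition_prob (big_partition_seq n (fun s : p.+2.-tuple nat => q ^+ head 0%N s)).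
  under eq_bigr do rewrite wE.
  by rewrite wE -mulr_sumr invfM mulrACA divff// mul1r.
have W0 : W != 0.
  (* The partition with the single part [n] already has positive weight. *)
  rewrite gt_eqF// /W; have := is_partition_single n p.+1.
  rewrite -mem_partition_seq => t0; rewrite (big_rem _ t0) /= ltr_pwDl//.
    rewrite divr_gt0 ?exprz_gt0//; exact: partition_series_gt0.
  by rewrite sumr_ge0// => t _; exact: limit_pmf_ge0.
have hs t : t \in partition_seq n p.+2 ->
    P (kappa @^-1` [set t]) = (w t / W)%:E.
  by rewrite mem_partition_seq => /hP ->; rewrite probE.
have mk A : measurable (kappa @^-1` A).
  rewrite -[X in measurable X]setTI; apply: (@measurable_funPT _ _ _ _ kappa) => //.
  exact: measurable_tuple_nat.
rewrite -[g \o _]/((g \o @centered R n p.+2) \o kappa).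
rewrite (@expectation_finite_support _ _ _ _ _ _ (partition_seq n p.+2))//.
- rewrite mulr_suml -sumEFin big_seq [RHS]big_seq; apply: eq_bigr => t ts /=.
  by rewrite hs// (centered_shift R t jp nc) -EFinM mulrA.
- exact: partition_seq_uniq.
- rewrite big_seq (eq_bigr (fun t => (w t / W)%:E)); last by move=> t; exact: hs.
  by rewrite -big_seq sumEFin -mulr_suml divff.
Qed.

(** * Passage to the limit *)

(** For fixed [j], the ceiling [c] determines [n], so the truncations are indexed by [c]. The sum is
    the integral over those vectors of the limit support that come from partitions of that [n]. *)
Lemma cvg_limit_sum (R : realType) (q : R) (p j : nat) (P : probability nat R)
    (g : 'rV[R]_p.+2 -> R) (M : R) :
  0 < q -> q < 1 -> (0 < j <= p.+2)%N ->
  (forall A, P A =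
    \esum_(l in @limit_support p.+2 j `&` pickle @^-1` A) (limit_pmf q j l)%:E) ->
  (forall x, `|g x| <= M) ->
  (\sum_(t <- partition_seq (p.+2 * c + j - p.+2) p.+2)
     g (int_rV R (shift_tuple c t)) * limit_pmf q j (shift_tuple c t))%:E
    @[c --> \oo] --> ('E_P[g \o @decode_rV R p.+2])%E.
Proof.
move=> q0 q1 jp PE gM; have /andP[j0 _] := jp.
have P1 l : limit_support j l -> P (decode_tuple p.+2 @^-1` [set l]) = (limit_pmf q j l)%:E.
  move=> ls; rewrite PE -(@esum_set1 _ _ l (fun l => (limit_pmf q j l)%:E)); last first.
    by rewrite lee_fin limit_pmf_ge0.
  congr (esum _ _); apply/seteqP; split=> [k [_] /=|k ->]; rewrite ?decode_tupleK//.
  by split=> //=; rewrite decode_tupleK.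
(* The subtraction may truncate at [c = 0], so only positive [c] are used below. *)
pose N c := (p.+2 * c + j - p.+2)%N.
have Nc c : (0 < c)%N -> (N c + p.+2 = p.+2 * c + j)%N.
  by move=> c0; rewrite /N subnK// (leq_trans _ (leq_addr _ _))// leq_pmulr.
pose s c := [seq shift_tuple c t | t <- partition_seq (N c) p.+2].
have := @cvg_integral_exhaustion _ _ _ P (g \o @decode_rV R p.+2) M
  (decode_tuple p.+2 @^-1` limit_support j) (fun c => decode_tuple p.+2 @^-1` [set` s c]).
(* Every subset of [nat] is measurable, so [I] proves both measurability premises. *)
move=> /(_ _ _ I _ (fun=> I)) lim.
apply: cvg_trans (lim _ _ _ _); last 4 first.
- by apply: (@measurable_EFin_factor _ _ _ _ (decode_tuple p.+2) (g \o @int_rV R p.+2)).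
- by move=> x; exact: gM.
- rewrite PE -[RHS](esum_limit_pmf q0 q1 jp); congr (esum _ _).
  by apply/seteqP; split=> [l []//|l ls]; split=> //=; rewrite decode_tupleK.
- move=> x xs; near=> c => /=; apply/mapP.
  have [|i|t tp ->] := @limit_support_shift p.+2 (N c) c j _ _ xs.
  + by apply: Nc; near: c; exact: nbhs_infty_gt.
  (* A given vector is captured as soon as [c] reaches the largest absolute value of its entries. *)
  + rewrite lerNl (le_trans (ler_norm _))// normrN -abszE lez_nat.
    rewrite (@leq_trans (\max_i absz (tnth (decode_tuple p.+2 x) i)))//.
      exact: leq_bigmax.
    by near: c; exact: nbhs_infty_ge.
  + by exists t => //; rewrite mem_partition_seq.
apply: near_eq_cvg; near=> c.
have c0 : (0 < c)%N by near: c; exact: nbhs_infty_gt.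
rewrite (@integral_preimage_seq _ _ _ P _ (decode_tuple p.+2) (s c) (g \o @int_rV R p.+2))//; last first.
  by rewrite map_inj_uniq ?partition_seq_uniq//; exact: shift_inj.
rewrite big_map -sumEFin big_seq [RHS]big_seq; apply: eq_bigr => t.
rewrite mem_partition_seq => tp; rewrite P1//.
exact: shift_limit_support (Nc _ c0) tp.
Unshelve. all: by end_near. Qed.

(** * Convergence along the residue class *)

Theorem theorem1 (R : realType) (m : nat) (hm : (2 <= m)%N)
    (q : R) (hq0 : 0 < q) (hq1 : q < 1)
    (d : nat -> measure_display) (T : forall n, measurableType (d n))
    (P : forall n, probability (T n) R)
    (kappa : forall n, {RV (P n) >-> m.-tuple nat})
    (hkappa : forall n, (1 <= n)%N -> forall k : m.-tuple nat,
       is_partition n k ->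
       P n (kappa n @^-1` [set k]) = (partition_prob q n k)%:E)
    (j0 : nat) (hj0 : (j0 < m)%N) :
  let j := (if j0 == 0 then m else j0)%N in
  exists (d' : measure_display) (T' : measurableType d')
    (P' : probability T' R) (Y : {RV P' >-> borel_rV R m}),
    has_pmf Y (limit_support j) (limit_pmf q j) /\
    cvg_in_distribution (within [set n | n = j0 %[mod m]] \oo)
      (fun n => centered_RV n (kappa n)) Y.
Proof.
case: m hm kappa hkappa hj0 => [|[|p]]// _ kappa hkappa hj0 j.
have jp : (0 < j <= p.+2)%N.
  by rewrite /j; case: eqP => [_|/eqP]; rewrite ?leqnn// -lt0n => ->; exact: ltnW.
have f0 (l : p.+2.-tuple int) : 0 <= limit_pmf q j l by exact: limit_pmf_ge0.
have [P' PE] := discrete_probability f0 (esum_limit_pmf hq0 hq1 jp).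
exists _, nat, P', (@decode_rV R p.+2); split; first split.
- move=> l ls; rewrite PE -(@esum_set1 _ _ l (fun l => (limit_pmf q j l)%:E)) ?lee_fin//.
  congr (esum _ _); apply/seteqP; split=> [k [_] /=|k ->].
    by rewrite /decode_rV decode_tupleK => /int_rV_inj.
  by split=> //=; rewrite /decode_rV decode_tupleK.
- rewrite PE -[RHS](esum_limit_pmf hq0 hq1 jp); congr (esum _ _).
  apply/seteqP; split=> [l []//|l ls]; split=> //=.
  by exists l => //; rewrite /decode_rV decode_tupleK.
move=> g _ [M gM].
(* The expectation is [num g / num 1]: taking [h = 1] gives the mass of the truncation, which tends
   to 1. *)
pose num (h : 'rV[R]_p.+2 -> R) c :=
  \sum_(t <- partition_seq (p.+2 * c + j - p.+2) p.+2)
    h (int_rV R (shift_tuple c t)) * limit_pmf q j (shift_tuple c t).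
have num_cvg h B : (forall x, `|h x| <= B) ->
    'E_P'[h \o @decode_rV R p.+2]%E \is a fin_num /\
    num h c @[c --> \oo] --> fine 'E_P'[h \o @decode_rV R p.+2]%E.
  move=> hB.
  have hE : 'E_P'[h \o @decode_rV R p.+2]%E \is a fin_num.
    rewrite unlock; apply: integrable_fin_num => //.
    apply: measurable_bounded_integrable => //.
    - exact: (le_lt_trans (probability_le1 _ _) (ltry _)).
    - by exists B; split=> [|x Bx y _]; [exact: num_real|exact: le_trans (hB _) (ltW Bx)].
  split=> //; have := cvg_limit_sum hq0 hq1 jp PE hB.
  by rewrite -(fineK hE) => /fine_cvg.
have [gE num_g] := num_cvg g M gM.
have [_ num_1] := num_cvg (fun=> 1) 1 (fun=> ltac:(by rewrite normr1)).
have E1 : 'E_P'[(fun=> 1%R) \o @decode_rV R p.+2]%E = 1%E by exact: expectation_cst.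
rewrite E1 /= in num_1.
(* This solves [n + m = m c + j]; the division is exact along the residue class, and [j <= m]
   prevents truncation. *)
pose c n := ((n + p.+2 - j) %/ p.+2)%N.
have ncE n : n = j0 %[mod p.+2] -> (n + p.+2 = p.+2 * c n + j)%N.
  rewrite (modn_small hj0) => nj.
  suff dvd : (p.+2 %| n + p.+2 - j)%N.
    by rewrite mulnC divnK// subnK// (leq_trans _ (leq_addl _ _))//; case/andP: jp.
  rewrite (divn_eq n p.+2) nj /j; case: eqP => [->|_].
    by rewrite addn0 addnK dvdn_mull.
  by rewrite -addnA addnC -addnA addKn dvdn_add// dvdn_mull.
(* Since [j <= m], the bound [n >= A m] forces [c n >= A]. *)
have c_oo : c n @[n --> within [set n | n = j0 %[mod p.+2]] \oo] --> \oo.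
  apply/cvgnyPge => A; rewrite near_withinE; near=> n => _.
  rewrite /c leq_divRL// -addnBA; last by case/andP: jp.
  by rewrite (leq_trans _ (leq_addr _ _))//; near: n; exact: nbhs_infty_ge.
have lim : (num g (c n) / num (fun=> 1) (c n))%:E
   @[n --> within [set n | n = j0 %[mod p.+2]] \oo] --> 'E_P'[g \o @decode_rV R p.+2]%E.
  rewrite -(fineK gE) -[fine _]divr1; apply/fine_cvgP; split; first exact: nearW.
  apply: cvgM; first exact: cvg_comp c_oo num_g.
  apply: cvgV => //; exact: cvg_comp c_oo num_1.
apply: cvg_trans lim; apply: near_eq_cvg.
rewrite near_withinE; near=> n => nj.
have nE := ncE n nj.
rewrite (@expectation_partition _ q p n (c n) j _ _ _ (kappa n) g)//; last first.
  by apply: hkappa; near: n; exact: nbhs_infty_gt.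
congr (_ / _)%:E.
  by rewrite /num -nE addnK.
by rewrite /num -nE addnK; under eq_bigr do rewrite mul1r.
Unshelve. all: by end_near. Qed.
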